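(* Let $0<k_\beta<k$ be integers, and let $\{P_{n,\theta}:\theta\in\mathbb{R}^k\}$, $n=1,2,\ldots$, be a sequence of statistical experiments on measurable spaces $(\mathcal{X}_n,\mathfrak{X}_n)$, with $\theta$ partitioned as $\theta=(\alpha',\beta')'$, $\alpha\in\mathbb{R}^{k-k_\beta}$, $\beta\in\mathbb{R}^{k_\beta}$. Suppose that for some $\alpha\in\mathbb{R}^{k-k_\beta}$ the sequence $P_{n,(\alpha',\gamma'/\sqrt n)'}$ is contiguous with respect to $P_{n,(\alpha',0)'}$ for every $\gamma\in\mathbb{R}^{k_\beta}$. Let $\hat\theta_n=(\hat\alpha_n',\hat\beta_n')'$ be an estimator sequence that is partially sparse, i.e. for every $\theta=(\alpha',\beta')'\in\mathbb{R}^k$ and $i=1,\ldots,k_\beta$, $\lim_{n\to\infty}P_{n,\theta}(\hat\beta_{n,i}=0)=1$ whenever $\beta_i=0$. Let $A$ be a $q\times k$ matrix of full row rank, partitioned conformably with $\theta$ as $A=(A_1,A_2)$ (so $A_1$ is $q\times(k-k_\beta)$ and $A_2$ is $q\times k_\beta$), satisfying $\operatorname{rank}A_1<q$. Let $C_n$ be a sequence of random sets in $\mathbb{R}^q$ based on $A\hat\theta_n$, in the sense that $P_{n,\theta}(A\hat\theta_n\in C_n)=1$ for all $\theta\in\mathbb{R}^k$. Assume that $C_n$ is a confidence set for $A\theta$ with asymptotic infimal coverage probability $\delta$, i.e. $$\delta=\liminf_{n\to\infty}\inf_{\theta\in\mathbb{R}^k}P_{n,\theta}(A\theta\in C_n).$$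 Then for every $t\ge0$, $$\liminf_{n\to\infty}\sup_{\theta\in\mathbb{R}^k}P_{n,\theta}\left(\sqrt n\,\operatorname{diam}(C_n)\ge t\right)\ge\delta .$$ (If the set inside the probability in the last display is not measurable, the probability is to be replaced by inner probability.)
   Context: For each $n$, every $P_{n,\theta}$ is a probability measure on $(\mathcal{X}_n,\mathfrak{X}_n)$; a prime denotes transpose. Contiguity: a sequence $Q_n$ of probability measures is contiguous with respect to $P_n$ if for all measurable $E_n\in\mathfrak{X}_n$, $P_n(E_n)\to0$ implies $Q_n(E_n)\to0$. Estimator: $\hat\theta_n$ is a measurable function $\mathcal{X}_n\to\mathbb{R}^k$; $\hat\beta_{n,i}$ and $\beta_i$ denote the $i$-th components of $\hat\beta_n$ and $\beta$. Random set in $\mathbb{R}^q$: $C_n=C_n(\omega)$ is a subset of $\mathbb{R}^q$ for every $\omega\in\mathcal{X}_n$ such that for every $\vartheta\in\mathbb{R}^q$ the set $\{\omega\in\mathcal{X}_n:\vartheta\in C_n(\omega)\}$ belongs to $\mathfrak{X}_n$. In the condition $P_{n,\theta}(A\hat\theta_n\in C_n)=1$ the probability is replaced by inner probability if the event is not measurable. $\operatorname{diam}(B)=\sup\{\|x-y\|:x\in B,\,y\in B\}$ (possibly $+\infty$), with $\|\cdot\|$ the Euclidean norm. *)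

(* Defs.v *)
From HB Require Import structures.
From mathcomp Require Export all_boot all_order all_algebra.
From mathcomp Require Export all_classical all_reals all_analysis.
Export Order.TTheory GRing.Theory Num.Theory.
Export numFieldNormedType.Exports.

Set Implicit Arguments.
Unset Strict Implicit.
Unset Printing Implicit Defensive.

Local Open Scope classical_set_scope.
Local Open Scope ring_scope.

(* The library norm on matrices is the sup norm, hence this one. *)
Definition enorm (R : realType) (q : nat) (x : 'cV[R]_q) : R :=
  Num.sqrt (\sum_(i < q) x i 0 ^+ 2).

(* [ereal_sup] gives [diam set0 = -oo]. *)
Definition diam (R : realType) (q : nat) (B : set 'cV[R]_q) : \bar R :=
  ereal_sup [set (enorm (z.1 - z.2))%:E | z in B `*` B].

Definition inner_prob (R : realType) (d : measure_display)
    (X : measurableType d) (P : probability X R) (E : set X) : \bar R :=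
  ereal_sup [set P B | B in [set B | measurable B /\ B `<=` E]].

Lemma inner_probE (R : realType) (d : measure_display)
    (X : measurableType d) (P : probability X R) (E : set X) :
  measurable E -> inner_prob P E = P E.
Proof.
move=> mE; apply/eqP; rewrite eq_le; apply/andP; split; last first.
  by apply: ereal_sup_ubound; exists E => /=; last by []; split.
by apply: ge_ereal_sup => _ [B [mB BE] <-]; apply: le_measure; rewrite ?inE.
Qed.

(* [contiguous P Q] : the sequence Q is contiguous with respect to P. *)
Definition contiguous (R : realType) (d : nat -> measure_display)
    (X : forall n, measurableType (d n))
    (P Q : forall n, probability (X n) R) : Prop :=
  forall E : forall n, set (X n), (forall n, measurable (E n)) ->
    P n (E n) @[n --> \oo] --> 0%E -> Q n (E n) @[n --> \oo] --> 0%E.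

(* Column vectors with the Borel sigma-algebra. *)
Definition borel_cV (R : realType) (k : nat) :=
  g_sigma_algebraType (@open 'cV[R]_k).

(* Sequences are indexed from 0: the entry n belongs to sample size n.+1. *)
Definition partially_sparse (R : realType) (ka kb : nat)
    (d : nat -> measure_display) (X : forall n, measurableType (d n))
    (P : forall n, 'cV[R]_(ka + kb) -> probability (X n) R)
    (thetahat : forall n, X n -> 'cV[R]_(ka + kb)) : Prop :=
  forall (theta : 'cV[R]_(ka + kb)) (i : 'I_kb),
    dsubmx theta i 0 = 0 ->
    P n theta [set w | dsubmx (thetahat n w) i 0 = 0] @[n --> \oo] --> 1%E.

Definition random_set (R : realType) (q : nat) (d : measure_display)
    (X : measurableType d) (C : X -> set 'cV[R]_q) : Prop :=
  forall v : 'cV[R]_q, measurable [set w | C w v].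

(* Main.v *)
Require Import Defs.

Set Implicit Arguments.
Unset Strict Implicit.
Unset Printing Implicit Defensive.

(** The lower bound is attained along a single local sequence
    [theta_n = (alpha, gamma / sqrt n)].  At [(alpha, 0)] sparsity forces the
    estimator [betahat] of the second block to vanish with probability tending
    to 1, and contiguity carries this over to [theta_n]: there the estimator
    sets to 0 a coefficient of size [gamma / sqrt n]
    ([sparse_neq0_cvg0]).  The set [C_n] contains [A thetahat] almost surely
    and [A theta_n] with asymptotic probability at least [delta].  When both
    points lie in [C_n] and [betahat = 0], the rescaled diameter of [C_n] is at
    least [|| A1 a + A2 gamma ||] for the uncontrolled vector
    [a = sqrt n (alpha - alphahat)].

    The rank condition handles the unknown [a]: since [rank A1 < q], some
    nonzero row vector [v] annihilates [A1], and [v A2 <> 0] because [A] has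
    full row rank.  Hence [v (A1 a + A2 gamma) = v A2 gamma] is the same for
    every [a] and can be made as large as desired by scaling [gamma]
    ([exists_large_shift]).

    The event that the diameter is large need not be measurable, nor need
    [A thetahat \in C_n]; [inner_prob_le] intersects the latter event of full
    inner probability with a measurable one at no cost.  What remains,
    [P (A theta_n \in C_n) <= P (betahat <> 0) + (inner probability)], passes
    to the limit inferior by [le_limn_einf_cvg0]. *)
Local Open Scope classical_set_scope.
Local Open Scope ring_scope.

Lemma enormZ (R : realType) (q : nat) (c : R) (x : 'cV[R]_q) :
  enorm (c *: x) = `|c| * enorm x.
Proof.
rewrite /enorm -sqrtr_sqr -sqrtrM ?sqr_ge0// mulr_sumr.
by congr Num.sqrt; apply: eq_bigr => i _; rewrite mxE exprMn.
Qed.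

Lemma le_coord_enorm (R : realType) (q : nat) (x : 'cV[R]_q) (i : 'I_q) :
  `|x i 0| <= enorm x.
Proof.
rewrite -sqrtr_sqr; apply: ler_wsqrtr; rewrite (bigD1 i)//= lerDl.
by apply: sumr_ge0 => j _; exact: sqr_ge0.
Qed.

(** A weak form of the Cauchy-Schwarz inequality: only the continuity of the
    linear form [v] for the Euclidean norm matters, so the l1 norm of [v] may
    serve as the constant. *)
Lemma norm_mul_row_col_le (R : realType) (q : nat) (v : 'rV[R]_q)
    (x : 'cV[R]_q) :
  `|(v *m x) 0 0| <= (\sum_i `|v 0 i|) * enorm x.
Proof.
rewrite mxE (le_trans (ler_norm_sum _ _ _))// mulr_suml.
by apply: ler_sum => i _; rewrite normrM ler_wpM2l// le_coord_enorm.
Qed.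

(** The rows of [A1] are dependent, and a dependency that also killed [A2]
    would be one between the rows of [A]. *)
Lemma exists_left_annihilator (F : fieldType) (q ka kb : nat)
    (A : 'M[F]_(q, ka + kb)) :
  row_free A -> (\rank (lsubmx A) < q)%N ->
  exists2 v : 'rV_q, v *m lsubmx A = 0 & v *m rsubmx A != 0.
Proof.
move=> Afree rkA1; have nfree : ~~ row_free (lsubmx A).
  by rewrite /row_free neq_ltn rkA1.
set v := nz_row (kermx (lsubmx A)); exists v.
  by apply/eqP; rewrite -sub_kermx nz_row_sub.
have v0 : v != 0 by rewrite nz_row_eq0 kermx_eq0.
apply: contra v0 => /eqP vA2.
rewrite -(mulmx_free_eq0 v Afree) -[A]hsubmxK mul_mx_row vA2.
have /eqP -> : v *m lsubmx A == 0 by rewrite -sub_kermx nz_row_sub.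
by rewrite row_mx0.
Qed.

(** A linear form [v] that vanishes on the range of [A1] sees only [gamma], so
    the norm is bounded below whatever the first block [a] is. *)
Lemma exists_large_shift (R : realType) (q ka kb : nat)
    (A : 'M[R]_(q, ka + kb)) (t : R) :
  row_free A -> (\rank (lsubmx A) < q)%N ->
  exists gamma : 'cV[R]_kb,
    forall a : 'cV[R]_ka, t <= enorm (A *m col_mx a gamma).
Proof.
move=> Afree rkA1.
have [v vA1 /rV0Pn[j vA2j]] := exists_left_annihilator Afree rkA1.
pose s := \sum_i `|v 0 i|; pose c := (v *m rsubmx A) 0 j.
have vM (a : 'cV[R]_ka) (g : 'cV[R]_kb) :
    v *m (A *m col_mx a g) = v *m rsubmx A *m g.
  by rewrite -{1}[A]hsubmxK mul_row_col mulmxDr !mulmxA vA1 mul0mx add0r.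
have s_gt0 : 0 < s.
  rewrite lt_neqAle sumr_ge0// andbT eq_sym; apply: contra vA2j.
  rewrite psumr_eq0// => /allP v0; suff -> : v = 0 by rewrite mul0mx mxE.
  apply/rowP => i; apply/eqP; rewrite mxE -normr_eq0.
  by apply: v0; rewrite mem_index_enum.
(* This choice makes [v A2 gamma = t * s], and [s] is the constant lost when
   [|v x|] is compared with [enorm x]. *)
exists ((t * s / c) *: delta_mx j 0) => a.
rewrite -(ler_pM2l s_gt0) (le_trans _ (norm_mul_row_col_le v _))//.
rewrite vM -scalemxAr mxE -colE mxE -/c divfK// mulrC.
exact: ler_norm.
Qed.

Local Open Scope ereal_scope.

(** An event of full inner probability contains measurable sets of probability
    arbitrarily close to 1, so it may be added to [M] for free even when it is
    not measurable itself. *)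
Lemma inner_prob_le (R : realType) (d : measure_display)
    (X : measurableType d) (P : probability X R) (M E F : set X) :
  measurable M -> inner_prob P E = 1 -> M `&` E `<=` F ->
  P M <= inner_prob P F.
Proof.
move=> mM PE MEF; apply/lee_addgt0Pr => e e_gt0.
have : 1 - e%:E < inner_prob P E.
  by rewrite PE lteBlDr// lteDl.
move=> /ereal_sup_gt[_ [B [mB BE] <-]] PB.
have PCB : P (~` B) <= e%:E.
  rewrite probability_setC// leeBlDr ?fin_num_measure// addeC -leeBlDr//.
  exact: ltW.
have MBF : P (M `&` B) <= inner_prob P F.
  apply: ereal_sup_ubound; exists (M `&` B) => //; split.
    exact: measurableI.
  by apply: subset_trans MEF; exact: setIS.
rewrite (le_trans _ (leeD MBF PCB))//.
have mMB : measurable (M `&` B) by exact: measurableI.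
have mCB : measurable (~` B) by exact: measurableC.
rewrite (le_trans _ (measureU2 _ mMB mCB))//.
apply: le_measure; rewrite ?inE//; first exact: measurableU.
by move=> w Mw; have [Bw|Bw] := pselect (B w); [left|right].
Qed.

Lemma le_limn_einf_near (R : realType) (u v : (\bar R)^nat) :
  (\forall n \near \oo, u n <= v n) -> limn_einf u <= limn_einf v.
Proof.
move=> [N _ uv]; rewrite !limn_einf_lim; apply: lee_lim.
- exact: is_cvg_einfs.
- exact: is_cvg_einfs.
exists N => // n /= Nn; apply: le_ereal_inf_tmp => _ [m /= nm <-].
apply: le_trans (uv m (leq_trans Nn nm)).
by apply: ereal_inf_lbound; exists m.
Qed.

(** The sequence [r] is eventually below any constant [e > 0], and a finite
    constant moves out of the limit inferior even where the values of [u] and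
    [v] are infinite. *)
Lemma le_limn_einf_cvg0 (R : realType) (u v r : (\bar R)^nat) :
  r n @[n --> \oo] --> 0 -> (forall n, u n <= r n + v n) ->
  limn_einf u <= limn_einf v.
Proof.
move=> r0 urv; apply/lee_addgt0Pr => e e_gt0.
rewrite addeC -limn_einf_shift//; apply: le_limn_einf_near.
have : \forall n \near \oo, r n <= e%:E.
  move/fine_cvgP: r0 => [rfin /cvgrPdist_le /(_ _ e_gt0)].
  apply: filterS2 rfin => n rfin; rewrite sub0r normrN => re.
  by rewrite -(fineK rfin) lee_fin (le_trans (ler_norm _)).
by apply: filterS => n re; rewrite (le_trans (urv n))// leeD2r.
Qed.

(** A coordinate being nonzero is an open condition, hence a generator of the
    Borel sigma-algebra. *)
Lemma measurable_dsubmx_neq0 (R : realType) (ka kb : nat)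
    (d : measure_display) (X : measurableType d) (f : X -> 'cV[R]_(ka + kb))
    (i : 'I_kb) :
  measurable_fun setT (f : X -> borel_cV R (ka + kb)) ->
  measurable [set w | (dsubmx (f w) i 0 != 0)%R].
Proof.
move=> mf; rewrite -[X in measurable X]setTI.
apply: (mf _ [set x : 'cV[R]_(ka + kb) | (dsubmx x i 0 != 0)%R]) => //.
apply: sub_gen_smallest.
rewrite (_ : mkset _ =
  (fun x : 'cV[R]_(ka + kb) => x (rshift ka i) 0%R) @^-1` [set~ 0%R]).
  apply: open_comp; first by move=> x _; exact: coord_continuous.
  by rewrite openC; exact: closed_eq.
by apply/seteqP; split => x /=; rewrite mxE => /eqP.
Qed.

(** Sparsity is stated coordinate by coordinate; as there are finitely many
    coordinates, the union bound makes them vanish simultaneously. *)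
Lemma sparse_neq0_cvg0 (R : realType) (ka kb : nat)
    (d : nat -> measure_display) (X : forall n, measurableType (d n))
    (P : forall n, 'cV[R]_(ka + kb) -> probability (X n) R)
    (thetahat : forall n, X n -> 'cV[R]_(ka + kb)) (alpha : 'cV[R]_ka) :
  (forall n, measurable_fun setT (thetahat n : X n -> borel_cV R (ka + kb))) ->
  partially_sparse P thetahat ->
  P n (col_mx alpha 0) (\bigcup_(i in [set: 'I_kb])
    [set w | (dsubmx (thetahat n w) i 0 != 0)%R]) @[n --> \oo] --> 0.
Proof.
move=> mth sparse; pose Q n := P n (col_mx alpha 0).
pose F n (i : 'I_kb) := [set w | (dsubmx (thetahat n w) i 0 != 0)%R].
have mF n i : measurable (F n i) by exact: measurable_dsubmx_neq0.
have F0 i : Q n (F n i) @[n --> \oo] --> 0.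
  have /sparse : dsubmx (col_mx alpha 0 : 'cV[R]_(ka + kb)) i 0%R = 0%R.
    by rewrite col_mxKd mxE.
  have SE n : [set w | dsubmx (thetahat n w) i 0%R = 0%R] = ~` F n i.
    apply/seteqP; split => w; rewrite /F /=; first by move=> ->; rewrite eqxx.
    by move=> /negP; rewrite negbK => /eqP.
  move=> /(cvgeB _ (cvg_cst 1)) => /(_ isT); rewrite subee//.
  apply: cvg_trans; apply: near_eq_cvg; near=> n.
  rewrite SE -probability_setC; last exact: measurableC.
  by rewrite setCK.
have F0sum : \sum_i Q n (F n i) @[n --> \oo] --> 0.
  rewrite -[X in _ --> X](_ : \sum_(i < kb) 0 = 0); last by rewrite big1.
  by apply: cvg_nnesum => // i _; apply: nearW => n; exact: measure_ge0.
apply: squeeze_cvge (cvg_cst 0) F0sum; apply: nearW => n.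
rewrite measure_ge0/=.
rewrite fsbig_seq ?index_enum_uniq//.
apply: content_sub_fsum => //.
  by apply: fin_bigcup_measurable => // i _; exact: mF.
by move=> w [i _ wi]; exists i => //=; rewrite mem_index_enum.
Unshelve. all: by end_near. Qed.

Local Close Scope ereal_scope.

Theorem theorem9 (R : realType) (ka kb q : nat)
  (ka_gt0 : (0 < ka)%N) (kb_gt0 : (0 < kb)%N)
  (d : nat -> measure_display) (X : forall n, measurableType (d n))
  (P : forall n, 'cV[R]_(ka + kb) -> probability (X n) R)
  (P_contiguous : exists alpha : 'cV[R]_ka, forall gamma : 'cV[R]_kb,
     contiguous (fun n => P n (col_mx alpha 0))
       (fun n => P n (col_mx alpha ((Num.sqrt n.+1%:R)^-1 *: gamma))))
  (thetahat : forall n, X n -> 'cV[R]_(ka + kb))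
  (thetahat_measurable : forall n,
     measurable_fun setT (thetahat n : X n -> borel_cV R (ka + kb)))
  (thetahat_sparse : partially_sparse P thetahat)
  (A : 'M[R]_(q, ka + kb)) (A_full_row_rank : row_free A)
  (rank_A1 : (\rank (lsubmx A) < q)%N)
  (C : forall n, X n -> set 'cV[R]_q)
  (C_random : forall n, random_set (C n))
  (C_based : forall n (theta : 'cV[R]_(ka + kb)),
     inner_prob (P n theta) [set w | C n w (A *m thetahat n w)] = 1%E)
  (delta : R)
  (C_coverage : delta%:E = limn_einf (fun n =>
     ereal_inf [set P n theta [set w | C n w (A *m theta)] | theta in setT]))
  (t : R) (t_ge0 : 0 <= t) :
  (delta%:E <= limn_einf (fun n => ereal_sup
     [set inner_prob (P n theta)
        [set w | t%:E <= (Num.sqrt n.+1%:R)%:E * diam (C n w)] |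
      theta in setT]))%E.
Proof.
have [alpha contig] := P_contiguous.
have [gamma large] := exists_large_shift t A_full_row_rank rank_A1.
pose theta n : 'cV[R]_(ka + kb) :=
  col_mx alpha ((Num.sqrt n.+1%:R)^-1 *: gamma).
pose E n := \bigcup_(i in [set: 'I_kb])
  [set w | dsubmx (thetahat n w) i 0 != 0].
have mE n : measurable (E n).
  apply: fin_bigcup_measurable => [|i _]; first exact: finite_finset.
  exact: measurable_dsubmx_neq0.
have E0 : P n (theta n) (E n) @[n --> \oo] --> 0%E.
  exact: contig (sparse_neq0_cvg0 _ thetahat_measurable thetahat_sparse).
rewrite C_coverage; apply: le_limn_einf_cvg0 E0 _ => n.
pose G := [set w | C n w (A *m theta n)].
apply: (@le_trans _ _ (P n (theta n) G)).
  by apply: ereal_inf_lbound; exists (theta n).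
have mG : measurable G by exact: C_random.
have mGE : measurable (G `\` E n) by exact: measurableD.
apply: (@le_trans _ _ (P n (theta n) (E n) + P n (theta n) (G `\` E n))%E).
  rewrite (le_trans _ (measureU2 _ (mE n) mGE))// le_measure ?inE//.
    exact: measurableU.
  by move=> w Gw; have [Ew|Ew] := pselect (E n w); [left|right].
(* The event [E n] has been paid for; the rest lies in the diameter event up to
   the almost sure event that [C n] contains [A *m thetahat n]. *)
rewrite leeD2l//; apply: le_ereal_sup_tmp; eexists; first by exists (theta n).
apply: inner_prob_le mGE (C_based n (theta n)) _ => w [[Gw nEw] Cw] /=.
have betahat0 : dsubmx (thetahat n w) = 0.
  apply/colP => i; rewrite [RHS]mxE; apply/eqP/negPn/negP => hi.
  by apply: nEw; exists i.
have rn_gt0 : 0 < Num.sqrt n.+1%:R :> R by rewrite sqrtr_gt0 ltr0n.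
(* Both points differ by [1 / sqrt n] times a vector whose second block is the
   fixed [gamma], to which the choice of [gamma] applies. *)
have shift : theta n - thetahat n w = (Num.sqrt n.+1%:R)^-1 *:
    col_mx (Num.sqrt n.+1%:R *: (alpha - usubmx (thetahat n w))) gamma.
  rewrite -[thetahat n w]vsubmxK betahat0 scale_col_mx scalerA.
  by rewrite mulVf ?gt_eqF// scale1r opp_col_mx add_col_mx subr0 col_mxKu.
have tle : t <= Num.sqrt n.+1%:R * enorm (A *m theta n - A *m thetahat n w).
  rewrite -mulmxBr shift -scalemxAr enormZ gtr0_norm ?invr_gt0//.
  by rewrite mulVKf ?gt_eqF.
rewrite (@le_trans _ _ (Num.sqrt n.+1%:R *
  enorm (A *m theta n - A *m thetahat n w))%:E) ?lee_fin// EFinM.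
rewrite lee_pmul2l// ?lte_fin//.
by apply: ereal_sup_ubound; exists (A *m theta n, A *m thetahat n w).
Qed.
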